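(* For $k=1,\dots,d$ let $\theta_k\in C(\mathbb{R};[0,+\infty))$ be even and subadditive with $\theta_k(0)=0$. Then the function $f\colon\mathbb{R}^d\times\mathbb{R}^d\times\mathbb{R}^d\to[0,+\infty)$ defined by $$f(i,j,\nu):=\sup_{(\xi_1,\dots,\xi_d)}\Big(\sum_{k=1}^d\theta_k\big(\langle i-j,\xi_k\rangle\big)^2\,|\langle\nu,\xi_k\rangle|^2\Big)^{1/2},$$ where the supremum is taken over all orthonormal bases $(\xi_k)_{k=1}^d$ of $\mathbb{R}^d$, is symmetric jointly convex.
   Context: Symmetric joint convexity: $f\colon\mathbb{R}^d\times\mathbb{R}^d\times\mathbb{R}^d\to[0,+\infty)$ is symmetric jointly convex if $f(i,j,\nu)=\sup_{h\in\mathbb{N}}\langle g_h(i)-g_h(j),\nu\rangle$ for all $(i,j,\nu)$ with $i\neq j$, where each $g_h\colon\mathbb{R}^d\to\mathbb{R}^d$ is uniformly continuous, bounded, and conservative (i.e., $g_h=\nabla G_h$ for some $G_h\in C^1(\mathbb{R}^d)$). *)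

(* Defs.v *)
From HB Require Import structures.
From mathcomp Require Import all_boot all_order all_algebra.
From mathcomp Require Import all_classical all_reals all_analysis.
Set Implicit Arguments.
Unset Strict Implicit.
Unset Printing Implicit Defensive.
Import Order.TTheory GRing.Theory Num.Theory.
Import numFieldNormedType.Exports.
Local Open Scope classical_set_scope.
Local Open Scope ring_scope.

Definition dot (R : realType) (d : nat) (u v : 'rV[R]_d) : R :=
  \sum_(k < d) u 0 k * v 0 k.

Definition gradient (R : realType) (d : nat) (G : 'rV[R]_d -> R)
    (x : 'rV[R]_d) : 'rV[R]_d :=
  \row_(k < d) 'D_(delta_mx 0 k) G x.

Definition C1 (R : realType) (d : nat) (G : 'rV[R]_d -> R) : Prop :=
  (forall x, differentiable G x) /\ continuous (gradient G).

Definition conservative (R : realType) (d : nat)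
    (g : 'rV[R]_d -> 'rV[R]_d) : Prop :=
  exists2 G : 'rV[R]_d -> R, C1 G & forall x, g x = gradient G x.

(* The norm and the uniform structure of 'rV[R]_d are those of the max norm;
   boundedness and uniform continuity are the same as for the Euclidean norm.
   The supremum is taken in \bar R, so that the equation with the
   real number f i j nu also says that the supremum is finite. *)
Definition symmetric_jointly_convex (R : realType) (d : nat)
    (f : 'rV[R]_d -> 'rV[R]_d -> 'rV[R]_d -> R) : Prop :=
  (forall i j nu, 0 <= f i j nu) /\
  exists g : nat -> 'rV[R]_d -> 'rV[R]_d,
    (forall h, [/\ unif_continuous (g h), bounded_fun (g h)
                 & conservative (g h)]) /\
    (forall i j nu, i != j ->
      (f i j nu)%:E =
        ereal_sup (range (fun h : nat => (dot (g h i - g h j) nu)%:E))).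

Definition orthonormal_basis (R : realType) (d : nat)
    (xi : d.-tuple 'rV[R]_d) : Prop :=
  basis_of fullv xi /\
  forall k l : 'I_d, dot (tnth xi k) (tnth xi l) = (k == l)%:R.

Definition basis_value (R : realType) (d : nat) (theta : 'I_d -> R -> R)
    (i j nu : 'rV[R]_d) (xi : d.-tuple 'rV[R]_d) : R :=
  Num.sqrt (\sum_(k < d) theta k (dot (i - j) (tnth xi k)) ^+ 2
                         * `|dot nu (tnth xi k)| ^+ 2).

Definition basis_values (R : realType) (d : nat) (theta : 'I_d -> R -> R)
    (i j nu : 'rV[R]_d) : set R :=
  [set basis_value theta i j nu xi | xi in [set xi | orthonormal_basis xi]].

(* [sup] is 0 on sets without a finite supremum, so this is the intended value
   only together with [has_sup (basis_values theta i j nu)]. *)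
Definition sup_basis (R : realType) (d : nat) (theta : 'I_d -> R -> R)
    (i j nu : 'rV[R]_d) : R :=
  sup (basis_values theta i j nu).

(* Main.v *)
Require Import Defs.
From HB Require Import structures.
From mathcomp Require Import all_boot all_order all_algebra.
From mathcomp Require Import ring lra.
From mathcomp Require Import all_classical all_reals all_analysis.
Import Order.TTheory GRing.Theory Num.Theory.
Import numFieldNormedType.Exports.
Local Open Scope classical_set_scope.
Local Open Scope ring_scope.

(** The function [f] in question is a supremum, over orthonormal bases, of the
    weighted Euclidean norms [basis_value theta i j nu xi]. The idea is to write
    each of them as a supremum of expressions [<g(i) - g(j), nu>] over fields [g]
    for which the inequality [<g(x) - g(y), v> <= f(x, y, v)] holds at all
    points, and then to thin out the resulting family to a sequence.

    Fix a basis [xi] and a triple [(i, j, nu)]. Cauchy-Schwarz writes the norm as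
    [sum_k a_k theta_k(<i - j, xi_k>) <nu, xi_k>] with [a] in the unit ball, and
    bounds this expression by the norm for every such [a]. An even subadditive
    [theta] satisfies [|theta(s) - theta(t)| <= theta(s - t)], with equality at
    [t = 0]. So [theta_k(<i - j, xi_k>)] is the largest possible increment, between
    [<j, xi_k>] and [<i, xi_k>], of a function of one variable whose increments
    are controlled by [theta_k], and [s |-> theta_k(s - <j, xi_k>)] attains it.
    Cutting this function off at the level [theta_k(<i - j, xi_k>)] makes it
    bounded without losing equality. The field
    [g(x) = sum_k a_k phi_k(<x, xi_k>) xi_k] built from these profiles
    ([exists_optimal_field]) is therefore exact at [(i, j, nu)] and stays below
    the norm everywhere. Each of its summands depends on [x] through [<x, xi_k>]
    only and is parallel to [xi_k], so [g] is the gradient of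
    [sum_k a_k Phi_k(<x, xi_k>)] with [Phi_k' = phi_k]
    ([ridge_field_conservative]).

    All the functions [(i, j, nu) |-> <g(i) - g(j), nu>] are continuous on a
    second countable space, so countably many of them have the same supremum as
    the whole family ([countable_subfamily_sup]). *)

(** * Antiderivatives of continuous functions *)

Section Antiderivative.
Context {R : realType} (phi : R -> R) (phi_cont : continuous phi).
Let mu := @lebesgue_measure R.

Let integral_from (a y : R) : R := (\int[mu]_(t in `[a, y]) phi t)%R.

Let phi_integrable (a b : R) : mu.-integrable `[a, b] (EFin \o phi).
Proof.
apply: continuous_compact_integrable; first exact: segment_compact.
exact: continuous_subspaceT.
Qed.

Let integral_from_chasles (a b y : R) : a <= b -> b <= y ->
  integral_from a y = integral_from a b + integral_from b y.
Proof.
move=> ab b_le_y; apply/eqP; rewrite addrC -subr_eq; apply/eqP.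
rewrite /integral_from Rintegral_itvB;
  [|exact: phi_integrable|by rewrite bnd_simp|by rewrite bnd_simp].
rewrite Rintegral_itv_obnd_cbnd//.
apply: integrableS (phi_integrable b y) => //.
by apply: subset_itvr; rewrite bnd_simp.
Qed.

(** The fundamental theorem of calculus differentiates the integral from a base
    point at points to its right only. Normalizing the integrals to vanish at 0
    makes them independent of the base point, so base points far enough to the
    left glue to an antiderivative on the whole line. *)
Lemma continuous_antiderivative :
  exists Phi : R -> R, forall x : R, is_derive x (1 : R) Phi (phi x).
Proof.
pose Phi x := integral_from (- (`|x| + 1)) x - integral_from (- (`|x| + 1)) 0.
have PhiE (N x : R) : 0 <= N -> - N <= x ->
    Phi x = integral_from (- N) x - integral_from (- N) 0.
  have base_indep (a b y : R) : a <= b -> b <= y -> b <= 0 ->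
      integral_from a y - integral_from a 0
      = integral_from b y - integral_from b 0.
    move=> ab b_le_y b0.
    rewrite (integral_from_chasles _ _ _ ab b_le_y).
    rewrite (integral_from_chasles _ _ _ ab b0).
    by rewrite opprD addrACA subrr add0r.
  have x1 : - (`|x| + 1) <= x.
    by rewrite lerNl (le_trans (ler_norm _))// normrN lerDl.
  have x0 : - (`|x| + 1) <= 0 by rewrite lerNl oppr0 addr_ge0.
  move=> N0 Nx; rewrite /Phi.
  have [le_xN|/ltW le_Nx] := leP (- (`|x| + 1)) (- N).
    by apply: base_indep => //; rewrite lerNl oppr0.
  by symmetry; apply: base_indep.
exists Phi => x; pose N := `|x| + 1.
have N0 : 0 <= N by rewrite addr_ge0.
have Nx : - N < x by rewrite ltrNl (le_lt_trans (ler_norm _))// normrN ltrDl.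
have [dF FE] := @continuous_FTC1_closed R phi (- N) x (x + 1)
  (ltr_pwDr ltr01 (lexx x)) (phi_integrable _ _) Nx (phi_cont x).
have dF' : is_derive x 1 (integral_from (- N)) (phi x).
  by apply: DeriveDef; rewrite // -derive1E.
have dG : is_derive x 1
    (fun y => integral_from (- N) y - integral_from (- N) 0) (phi x).
  rewrite -[phi x]subr0; exact: is_deriveB.
apply: near_eq_is_derive dG.
near=> y; rewrite (PhiE N)//; apply: ltW; near: y.
exact: lt_nbhsr.
Unshelve. all: by end_near. Qed.

End Antiderivative.

(** * The inner product and functions of one linear form *)

Section Dot.
Context {R : realType} {d : nat}.
Implicit Types u v w : 'rV[R]_d.

Lemma dotC u v : dot u v = dot v u.
Proof. by apply: eq_bigr => k _; rewrite mulrC. Qed.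

Fact dot_is_linear u : linear (dot u : 'rV[R]_d -> R).
Proof.
move=> a v w; rewrite /dot scaler_sumr -big_split; apply: eq_bigr => k _ /=.
by rewrite !mxE mulrDr scalerAr.
Qed.

HB.instance Definition _ u :=
  GRing.isLinear.Build R 'rV[R]_d R _ (dot u) (dot_is_linear u).

Lemma dotBl u v w : dot (u - v) w = dot u w - dot v w.
Proof. by rewrite dotC linearB; congr (_ - _); exact: dotC. Qed.

Lemma dot_delta u k : dot u (delta_mx 0 k) = u 0 k.
Proof.
rewrite /dot (bigD1 k)//= mxE !eqxx mulr1 big1 ?addr0// => l lk.
by rewrite mxE eqxx (negPf lk) mulr0.
Qed.

Lemma continuous_dot {X : topologicalType} (f g : X -> 'rV[R]_d) :
  continuous f -> continuous g -> continuous (fun x => dot (f x) (g x) : R).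
Proof.
move=> f_cont g_cont; apply: continuous_big.
  by move=> x; exact: add_continuous.
move=> k _ x; apply: cvgM.
  exact: (continuous_comp (f_cont x) (@coord_continuous _ _ _ 0 k (f x))).
exact: (continuous_comp (g_cont x) (@coord_continuous _ _ _ 0 k (g x))).
Qed.

Lemma dot_continuous u : continuous (dot u : 'rV[R]_d -> R).
Proof.
apply: (continuous_dot (cst u) id); first exact: cst_continuous.
by move=> x; exact: cvg_id.
Qed.

Lemma ridge_continuous (phi : R -> R) u :
  continuous phi -> continuous (phi \o dot u).
Proof.
move=> phi_cont x; apply: continuous_comp; first exact: dot_continuous.
exact: phi_cont.
Qed.

Lemma is_derive_ridge (Phi phi : R -> R) (xi x v : 'rV[R]_d) :
  (forall t : R, is_derive t (1 : R) Phi (phi t)) ->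
  differentiable (Phi \o dot xi) x /\
  is_derive x v (Phi \o dot xi) (phi (dot xi x) * dot xi v).
Proof.
move=> Phi_phi.
have dPhi : differentiable Phi (dot xi x).
  by apply/derivable1_diffP; exact: ex_derive.
have ddot : differentiable (dot xi) x.
  by apply: linear_differentiable; exact: dot_continuous.
have dcomp : differentiable (Phi \o dot xi) x by exact: differentiable_comp.
split=> //; apply: DeriveDef; first exact: diff_derivable.
rewrite deriveE// diff_comp//= diff_lin; last exact: dot_continuous.
by rewrite diff1E//= derive1E derive_val mulrC.
Qed.

End Dot.

(** * Ridge fields *)

Section RidgeField.
Context {R : realType} {d n : nat}.
Context (xi : 'I_n -> 'rV[R]_d) (phi : 'I_n -> R -> R).

Definition ridge_field (x : 'rV[R]_d) : 'rV[R]_d :=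
  \sum_(k < n) phi k (dot (xi k) x) *: xi k.

Lemma dot_ridge_fieldB (x y nu : 'rV[R]_d) :
  dot (ridge_field x - ridge_field y) nu =
  \sum_(k < n) (phi k (dot (xi k) x) - phi k (dot (xi k) y)) * dot nu (xi k).
Proof.
rewrite dotC /ridge_field -sumrB linear_sum; apply: eq_bigr => k _.
by rewrite -scalerBl linearZ.
Qed.

(** Each summand points along the gradient [xi k] of the linear form on which its
    profile depends; this is why antiderivatives of the profiles give a
    potential. *)
Lemma ridge_field_conservative :
  (forall k, continuous (phi k)) -> conservative ridge_field.
Proof.
move=> phi_cont.
have /choice[Phi PhiP] k := continuous_antiderivative (phi k) (phi_cont k).
pose G := \sum_(k < n) (Phi k \o dot (xi k)).
have gradG : ridge_field = gradient G.
  apply/funext => x; apply/rowP => l; rewrite mxE.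
  have dG k := is_derive_ridge _ _ (xi k) x (delta_mx 0 l) (PhiP k).
  rewrite derive_sum; last by move=> k; have [_ ?] := dG k.
  rewrite summxE; apply: eq_bigr => k _; rewrite mxE -dot_delta.
  by have [_ ?] := dG k; rewrite derive_val.
exists G => [|x]; last by rewrite gradG.
split=> [x|].
  apply: differentiable_sum => k.
  by have [? _] := is_derive_ridge _ _ (xi k) x 0 (PhiP k).
rewrite -gradG; apply: continuous_big; first by move=> x; exact: add_continuous.
move=> k _ x.
exact: (cvgZr_tmp (a := xi k)
  (ridge_continuous (phi k) (xi k) (phi_cont k) x)).
Qed.

Lemma ridge_field_bounded (M : 'I_n -> R) :
  (forall k t, `|phi k t| <= M k) -> bounded_fun ridge_field.
Proof.
move=> phi_M; exists (\sum_(k < n) M k * `|xi k|); split; first exact: num_real.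
move=> B /ltW MB x _; apply: le_trans MB; apply: (le_trans (ler_norm_sum _ _ _)).
by apply: ler_sum => k _; rewrite normrZ ler_wpM2r.
Qed.

(** The increments of the field between [x] and [y] are at most
    [W (x - y) = \sum_k omega k (<xi k, x - y>) |xi k|], and [W] is continuous
    with [W 0 = 0]. *)
Lemma ridge_field_unif_continuous (omega : 'I_n -> R -> R) :
  (forall k, continuous (omega k)) -> (forall k, omega k 0 = 0) ->
  (forall k s t, `|phi k s - phi k t| <= omega k (s - t)) ->
  unif_continuous ridge_field.
Proof.
move=> omega_cont omega0 phi_omega.
pose W z := \sum_(k < n) omega k (dot (xi k) z) * `|xi k|.
have W0 : W 0 = 0.
  by rewrite /W big1// => k _; rewrite linear0 omega0 mul0r.
have W_cont : continuous W.
  apply: continuous_big; first by move=> x; exact: add_continuous.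
  move=> k _ x.
  exact: (cvgMr_tmp (b := `|xi k|)
    (ridge_continuous (omega k) (xi k) (omega_cont k) x)).
have ridge_W x y : `|ridge_field x - ridge_field y| <= W (x - y).
  rewrite /ridge_field -sumrB; apply: (le_trans (ler_norm_sum _ _ _)).
  apply: ler_sum => k _; rewrite -scalerBl normrZ ler_wpM2r//.
  by rewrite linearB.
apply/unif_continuousP => e e0.
have : \forall z \near (0 : 'rV[R]_d), W z < e.
  by apply: (W_cont 0 _ (lt_nbhsl _)); rewrite W0.
move=> /nbhs_ballP[r /= r0 ballW]; exists r => // -[x y].
rewrite -!ball_normE => /= xy.
apply: (le_lt_trans (ridge_W x y)); apply: ballW.
by rewrite -ball_normE /= sub0r normrN.
Qed.

Lemma ridge_field_admissible (omega : 'I_n -> R -> R) (M : 'I_n -> R) :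
  (forall k, continuous (omega k)) -> (forall k, omega k 0 = 0) ->
  (forall k s t, `|phi k s - phi k t| <= omega k (s - t)) ->
  (forall k t, `|phi k t| <= M k) ->
  [/\ unif_continuous ridge_field, bounded_fun ridge_field
    & conservative ridge_field].
Proof.
move=> omega_cont omega0 phi_omega phi_M; split.
- exact: ridge_field_unif_continuous omega0 phi_omega.
- exact: ridge_field_bounded phi_M.
- apply: ridge_field_conservative => k t; apply/cvgrPdist_lt => e e0.
  have omega_small : \forall s \near t, omega k (t - s) < e.
    have sub_cont : {for t, continuous (omega k \o (fun s => t - s))}.
      apply: continuous_comp; last exact: omega_cont.
      by apply: cvgB; [exact: cvg_cst|exact: cvg_id].
    by apply: (sub_cont _ (lt_nbhsl _)); rewrite /= subrr omega0.
  by apply: filterS omega_small => s; exact: le_lt_trans.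
Qed.

End RidgeField.

Lemma conservative_continuous {R : realType} {d : nat}
    (g : 'rV[R]_d -> 'rV[R]_d) : conservative g -> continuous g.
Proof.
move=> [G [_ gradG_cont] gE].
by rewrite (_ : g = gradient G)//; exact/funext.
Qed.

(** * Countable subfamilies with the same supremum *)

(** A ball with centre in the dense set and radius [m.+1%:R^-1], together with a
    rational [q], is one of countably many requests: find a member of the family
    which exceeds [q] on the ball. One answer for each request that has an answer
    is enough, because by continuity every strict inequality [r < u p x] makes
    [p] an answer to some request whose ball contains [x] and whose [q] is above
    [r]. *)
Lemma countable_subfamily_sup {R : realType} {X : pseudoMetricType R}
    {C : countType} (c : C -> X) {P : Type} (p0 : P) (u : P -> X -> R) :
  (forall x e, 0 < e -> exists k, ball (c k) e x) ->
  (forall p, continuous (u p)) ->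
  exists s : nat -> P, forall x p r, r < u p x -> exists n, r < u (s n) x.
Proof.
move=> c_dense u_cont.
pose exceeds (b : C * nat * rat) (p : P) :=
  forall y, ball (c b.1.1) b.1.2.+1%:R^-1 y -> ratr b.2 < u p y.
pose pick b := if pselect (exists p, exceeds b p) is left ex
               then projT1 (cid ex) else p0.
have pickP b p : exceeds b p -> exceeds b (pick b).
  rewrite /pick; case: pselect => [ex _|nex bp]; last by case: nex; exists p.
  exact: (projT2 (cid ex)).
exists (fun n => oapp pick p0 (unpickle n)) => x p r r_lt.
have [q] := rat_in_itvoo r_lt; rewrite in_itv/= => /andP[r_lt_q q_lt].
have /nbhs_ballP[e /= e0 ballS] : nbhs x [set y | ratr q < u p y].
  exact: (u_cont p x _ (lt_nbhsr q_lt)).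
(* A ball of radius below [e / 2] that contains [x] lies in [ball x e]. *)
have [m m_lt] : exists m : nat, m.+1%:R^-1 < e / 2.
  have [m _ /(_ m (leqnn m))] :=
    near_infty_natSinv_lt (PosNum (divr_gt0 e0 (ltr0Sn R 1))).
  by exists m.
have [k xk] := c_dense x m.+1%:R^-1 ltac:(by rewrite invr_gt0).
exists (pickle (k, m, q)); rewrite pickleK /=.
apply: (lt_trans r_lt_q); apply: (pickP (k, m, q) p) => // y /= yk.
apply: ballS; apply: (ball_splitr (z := c k)).
  by apply: le_ball xk; exact: ltW.
by apply: le_ball yk; exact: ltW.
Qed.

Lemma rational_vectors_dense {R : realType} {d : nat} (v : 'rV[R]_d) (e : R) :
  0 < e -> exists q : 'rV[rat]_d, ball (map_mx ratr q : 'rV[R]_d) e v.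
Proof.
move=> e0.
have /choice[q qP] (l : 'I_d) : exists q : rat, `|ratr q - v 0 l| < e.
  have [q] : exists q, ratr q \in `](v 0 l - e), (v 0 l + e)[.
    by apply: rat_in_itvoo; rewrite ltrBlDr -addrA ltrDl addr_gt0.
  by rewrite in_itv /= => ?; exists q; rewrite ltr_distl.
exists (\row_l q l); split=> // i l.
by rewrite ord1 !mxE -ball_normE /=.
Qed.

(** * Even subadditive functions *)

Section EvenSubadditive.
Context {R : realType} (theta : R -> R).
Context (theta_even : forall t, theta (- t) = theta t).
Context (theta_subadd : forall s t, theta (s + t) <= theta s + theta t).

Lemma dist_even_subadditive s t : `|theta s - theta t| <= theta (s - t).
Proof.
have le_theta x y : theta x - theta y <= theta (x - y).
  by rewrite lerBlDr -{1}[x](subrK y) theta_subadd.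
rewrite ler_norml le_theta andbT lerNl opprB -[leRHS]theta_even opprB.
exact: le_theta.
Qed.

Lemma dist_min_even_subadditive (M s t : R) :
  `|Num.min (theta s) M - Num.min (theta t) M| <= theta (s - t).
Proof.
apply: le_trans (dist_even_subadditive s t).
have := ler_norm (theta s - theta t); have := ler_norm (theta t - theta s).
rewrite [`|theta t - _|]distrC; set n := `|theta s - theta t| => ts st.
by case: (leP (theta s) M) => sM; case: (leP (theta t) M) => tM;
  rewrite ler_norml; apply/andP; split; lra.
Qed.

End EvenSubadditive.

(** * Orthonormal bases *)

Section OrthonormalBases.
Context {R : realType} {d : nat}.
Implicit Types (v : 'rV[R]_d) (xi : d.-tuple 'rV[R]_d).

Lemma orthonormal_basis_delta :
  orthonormal_basis [tuple delta_mx 0 k : 'rV[R]_d | k < d].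
Proof.
split; last first.
  by move=> k l; rewrite !tnth_mktuple dot_delta mxE eqxx eq_sym.
rewrite basisEdim size_tuple dimvf /dim /= mul1n leqnn andbT.
apply/subvP => v _; rewrite [v]row_sum_delta.
apply: memv_suml => k _; apply/memvZ/memv_span.
by rewrite -(tnth_mktuple (fun k => delta_mx 0 k) k) mem_tnth.
Qed.

Lemma le_norm_dot_orthonormal xi v k : orthonormal_basis xi ->
  `|dot v (tnth xi k)| <= \sum_(l < d) `|v 0 l|.
Proof.
move=> [_ xi_on]; apply: (le_trans (ler_norm_sum _ _ _)).
apply: ler_sum => l _; rewrite normrM ler_piMr//.
have : \sum_(m < d) tnth xi k 0 m ^+ 2 = 1.
  transitivity (dot (tnth xi k) (tnth xi k)); last by rewrite xi_on eqxx.
  by apply: eq_bigr => m _; rewrite expr2.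
rewrite (bigD1 l)//= => xi1.
rewrite -(@expr_le1 _ 2)// -normrX ger0_norm ?sqr_ge0// -xi1 lerDl.
by apply: sumr_ge0 => m _; exact: sqr_ge0.
Qed.

(** The arguments [<i - j, xi_k>] stay in a segment that does not depend on the
    basis, and a continuous function is bounded on a segment. *)
Lemma has_sup_basis_values (theta : 'I_d -> R -> R) (i j nu : 'rV[R]_d) :
  (forall k, continuous (theta k)) -> (forall k t, 0 <= theta k t) ->
  has_sup (basis_values theta i j nu).
Proof.
move=> theta_cont theta_ge0; split.
  by exists (basis_value theta i j nu [tuple delta_mx 0 k | k < d]);
    exists [tuple delta_mx 0 k | k < d] => //; exact: orthonormal_basis_delta.
pose L := \sum_(l < d) `|(i - j) 0 l|; pose N := \sum_(l < d) `|nu 0 l|.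
have L0 : 0 <= L by apply: sumr_ge0.
have /choice[C theta_C] (k : 'I_d) :
    exists C : R, forall t, `|t| <= L -> theta k t <= C.
  have NLL : - L <= L by rewrite (le_trans _ L0)// oppr_le0.
  have [m _ mP] := EVT_max NLL (continuous_subspaceT (theta_cont k)).
  by exists (theta k m) => t tL; apply: mP; rewrite in_itv /= -ler_norml.
exists (Num.sqrt (\sum_(k < d) C k ^+ 2 * N ^+ 2)) => _ [xi xi_on <-].
rewrite /basis_value; apply: ler_wsqrtr; apply: ler_sum => k _.
have le_C : theta k (dot (i - j) (tnth xi k)) <= C k.
  by apply: theta_C; exact: le_norm_dot_orthonormal.
apply: ler_pM; rewrite ?sqr_ge0//; apply: lerXn2r => //; rewrite ?nnegrE//.
- exact: le_trans le_C.
- exact: sumr_ge0.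
- exact: le_norm_dot_orthonormal.
Qed.

End OrthonormalBases.

(** * Optimal fields for one basis *)

(** Cauchy-Schwarz, by summing [2 T a_k c_k <= T^2 a_k^2 + c_k^2] for [T] equal to
    the norm of [c]. *)
Lemma sum_mul_le_sqrt {R : realType} {n : nat} (a c : 'I_n -> R) :
  \sum_(k < n) a k ^+ 2 <= 1 ->
  \sum_(k < n) a k * c k <= Num.sqrt (\sum_(k < n) c k ^+ 2).
Proof.
move=> a1; set T := Num.sqrt _.
have c2_ge0 : 0 <= \sum_(k < n) c k ^+ 2.
  by apply: sumr_ge0 => k _; exact: sqr_ge0.
have T2 : T ^+ 2 = \sum_(k < n) c k ^+ 2 by rewrite sqr_sqrtr.
have T0 : 0 <= T by exact: sqrtr_ge0.
move: T0; rewrite le_eqVlt => /orP[/eqP T0|T_gt0].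
  rewrite big1 -?T0// => k _.
  have /psumr_eq0P c0 : \sum_(k < n) c k ^+ 2 = 0 by rewrite -T2 -T0 expr0n.
  have /eqP : c k ^+ 2 = 0 by apply: c0 => // l _; exact: sqr_ge0.
  by rewrite sqrf_eq0 => /eqP ->; rewrite mulr0.
have : 2 * T * \sum_(k < n) a k * c k <= 2 * T * T.
  apply: (@le_trans _ _
    (T ^+ 2 * \sum_(k < n) a k ^+ 2 + \sum_(k < n) c k ^+ 2)).
    rewrite !mulr_sumr -big_split /=; apply: ler_sum => k _.
    have := sqr_ge0 (T * a k - c k); lra.
  rewrite -T2; have := ler_wpM2l (sqr_ge0 T) a1; lra.
by rewrite ler_pM2l// mulr_gt0.
Qed.

Section OptimalField.
Context {R : realType} {d : nat} (theta : 'I_d -> R -> R).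
Context (theta_cont : forall k, continuous (theta k)).
Context (theta_ge0 : forall k t, 0 <= theta k t).
Context (theta_even : forall k t, theta k (- t) = theta k t).
Context (theta_subadd : forall k s t, theta k (s + t) <= theta k s + theta k t).
Context (theta_0 : forall k, theta k 0 = 0).

Lemma ridge_field_le_basis_value (xi : d.-tuple 'rV[R]_d) (a : 'I_d -> R)
    (phi : 'I_d -> R -> R) (x y v : 'rV[R]_d) :
  \sum_(k < d) a k ^+ 2 <= 1 ->
  (forall k s t, `|phi k s - phi k t| <= `|a k| * theta k (s - t)) ->
  dot (ridge_field (tnth xi) phi x - ridge_field (tnth xi) phi y) v
    <= basis_value theta x y v xi.
Proof.
move=> a1 phi_theta; rewrite dot_ridge_fieldB /basis_value.
under [in leRHS]eq_bigr do rewrite -exprMn.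
apply: (le_trans _ (sum_mul_le_sqrt (fun k => `|a k|) _ _)); last first.
  by under eq_bigr do rewrite real_normK ?num_real//.
apply: ler_sum => k _; apply: (le_trans (ler_norm _)).
rewrite normrM mulrA ler_wpM2r// (dotC (x - y)) linearB.
exact: phi_theta.
Qed.

Lemma exists_optimal_field (xi : d.-tuple 'rV[R]_d) (i j nu : 'rV[R]_d) :
  exists g : 'rV[R]_d -> 'rV[R]_d,
    [/\ [/\ unif_continuous g, bounded_fun g & conservative g],
        forall x y v, dot (g x - g y) v <= basis_value theta x y v xi
      & dot (g i - g j) nu = basis_value theta i j nu xi].
Proof.
pose e k := tnth xi k.
pose M k := theta k (dot (i - j) (e k)).
pose b k := M k * dot nu (e k).
pose S := basis_value theta i j nu xi.
have b_ge0 : 0 <= \sum_(k < d) b k ^+ 2.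
  by apply: sumr_ge0 => k _; exact: sqr_ge0.
have SE : S ^+ 2 = \sum_(k < d) b k ^+ 2.
  rewrite /S /basis_value.
  under eq_bigr do rewrite real_normK ?num_real// -exprMn.
  by rewrite sqr_sqrtr.
(* The equality case of Cauchy-Schwarz is [a] proportional to [b]. When [S = 0]
   the quotients are 0 by convention, and the zero field is exact. *)
pose a k := b k / S.
pose phi k s := a k * Num.min (theta k (s - dot (e k) j)) (M k).
have a1 : \sum_(k < d) a k ^+ 2 <= 1.
  under eq_bigr do rewrite exprMn.
  rewrite -mulr_suml -SE -exprMn; have [->|S0] := eqVneq S 0.
    by rewrite mul0r expr0n.
  by rewrite divff// expr1n.
have phi_theta k s t : `|phi k s - phi k t| <= `|a k| * theta k (s - t).
  rewrite -mulrBr normrM ler_wpM2l//.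
  have -> : s - t = (s - dot (e k) j) - (t - dot (e k) j).
    by rewrite opprB addrA subrK.
  exact: dist_min_even_subadditive.
exists (ridge_field e phi); split.
- apply: (@ridge_field_admissible _ _ _ _ _ (fun k t => `|a k| * theta k t)
           (fun k => `|a k| * M k)) => //.
  + by move=> k t; apply: cvgMl_tmp; exact: theta_cont.
  + by move=> k; rewrite theta_0 mulr0.
  + move=> k t; rewrite normrM ler_wpM2l// ger0_norm ?ge_min ?lexx ?orbT//.
    by rewrite le_min !theta_ge0.
- by move=> x y v; exact: ridge_field_le_basis_value a1 phi_theta.
- rewrite dot_ridge_fieldB -/S.
  transitivity (\sum_(k < d) b k ^+ 2 / S).
    apply: eq_bigr => k _; rewrite /phi subrr theta_0.
    rewrite ![dot (e k) _]dotC -dotBl -/(M k).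
    rewrite minxx min_l ?theta_ge0// mulr0 subr0.
    by rewrite /a expr2 /b; ring.
  rewrite -mulr_suml -SE expr2; have [->|S0] := eqVneq S 0.
    by rewrite !mul0r.
  by rewrite mulfK.
Qed.

End OptimalField.

(** * Symmetric joint convexity *)

Theorem proposition4p5 (R : realType) (d : nat) (theta : 'I_d -> R -> R)
    (theta_cont : forall k, continuous (theta k))
    (theta_ge0 : forall k t, 0 <= theta k t)
    (theta_even : forall k t, theta k (- t) = theta k t)
    (theta_subadd : forall k s t, theta k (s + t) <= theta k s + theta k t)
    (theta_0 : forall k, theta k 0 = 0) :
  (forall i j nu : 'rV[R]_d, has_sup (basis_values theta i j nu)) /\
  symmetric_jointly_convex (sup_basis theta).
Proof.
have values_sup (i j nu : 'rV[R]_d) : has_sup (basis_values theta i j nu).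
  exact: has_sup_basis_values.
have value_le_sup (i j nu : 'rV[R]_d) xi : orthonormal_basis xi ->
    basis_value theta i j nu xi <= sup_basis theta i j nu.
  move=> xi_on; apply: ub_le_sup; first exact: (values_sup i j nu).2.
  by exists xi.
split=> //; split.
  move=> i j nu.
  apply: le_trans (value_le_sup i j nu _ orthonormal_basis_delta).
  exact: sqrtr_ge0.
pose admissible (g : 'rV[R]_d -> 'rV[R]_d) :=
  [/\ unif_continuous g, bounded_fun g & conservative g] /\
  forall i j nu, dot (g i - g j) nu <= sup_basis theta i j nu.
have optimal i j nu xi : orthonormal_basis xi ->
    exists2 g, admissible g & dot (g i - g j) nu = basis_value theta i j nu xi.
  move=> xi_on.
  have [g [g_adm g_le gE]] := exists_optimal_field theta theta_cont theta_ge0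
    theta_even theta_subadd theta_0 xi i j nu.
  exists g => //; split=> // x y v.
  exact: le_trans (g_le x y v) (value_le_sup x y v xi xi_on).
have [g0 g0_adm _] := optimal 0 0 0 _ orthonormal_basis_delta.
pose u (g : {g | admissible g}) (x : 'rV[R]_d * 'rV[R]_d * 'rV[R]_d) : R :=
  dot (sval g x.1.1 - sval g x.1.2) x.2.
pose c (q : 'rV[rat]_d * 'rV[rat]_d * 'rV[rat]_d) :
    'rV[R]_d * 'rV[R]_d * 'rV[R]_d :=
  (map_mx ratr q.1.1, map_mx ratr q.1.2, map_mx ratr q.2).
have [||s sP] := countable_subfamily_sup c (exist _ g0 g0_adm) u.
- move=> [[i j] nu] e e0.
  have [qi ?] := rational_vectors_dense i e e0.
  have [qj ?] := rational_vectors_dense j e e0.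
  have [qn ?] := rational_vectors_dense nu e e0.
  by exists (qi, qj, qn).
- move=> g; have [[_ _ /conservative_continuous g_cont] _] := svalP g.
  have g_comp (p : 'rV[R]_d * 'rV[R]_d -> 'rV[R]_d) :
      continuous p -> continuous (sval g \o p \o @fst _ 'rV[R]_d).
    move=> p_cont x; apply: continuous_comp; first exact: cvg_fst.
    by apply: continuous_comp; [exact: p_cont|exact: g_cont].
  apply: continuous_dot => x; last exact: cvg_snd.
  have fst_cont : continuous (@fst 'rV[R]_d 'rV[R]_d) by move=> y; exact: cvg_fst.
  have snd_cont : continuous (@snd 'rV[R]_d 'rV[R]_d) by move=> y; exact: cvg_snd.
  exact: (cvgB (g_comp fst fst_cont x) (g_comp snd snd_cont x)).
exists (fun h => sval (s h)); split; first by move=> h; exact: (svalP (s h)).1.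
move=> i j nu _; apply/eqP; rewrite eq_le; apply/andP; split; last first.
  apply: ge_ereal_sup => _ [h _ <-]; rewrite lee_fin.
  by have [_ le_sup] := svalP (s h); exact: le_sup.
apply/lee_subgt0Pr => e e0.
have [_ [xi xi_on <-] xi_gt] := sup_adherent e0 (values_sup i j nu).
have [g g_adm gE] := optimal i j nu xi xi_on.
have [h h_gt] : exists h, sup_basis theta i j nu - e < u (s h) (i, j, nu).
  by apply: (sP _ (exist _ g g_adm)); rewrite /u /= gE.
apply: le_ereal_sup_tmp; exists (u (s h) (i, j, nu))%:E; first by exists h.
by rewrite -EFinB lee_fin; exact: ltW.
Qed.
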